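(* Let $R$ be a commutative ring with unity. The multiplicative semigroup of $R$ is a semilattice of semigroups $\mathcal{S}[\mathrm{Im}(\varepsilon\delta); R_e]$; that is, $\mathrm{Im}(\varepsilon\delta)$ is a semilattice under ideal multiplication, $R$ is the disjoint union of the subsemigroups $R_e$, $e\in \mathrm{Im}(\varepsilon\delta)$, and $R_eR_f\subseteq R_{ef}$ for all $e,f\in\mathrm{Im}(\varepsilon\delta)$.
   Context: $D$ is the set of all ideals of $R$, a commutative semigroup under ideal multiplication, and $E(D)=\{J\in D : J^2=J\}$. The map $\delta:R\to D$ is $\delta(x)=(x)$, the principal ideal generated by $x$. The map $\varepsilon: D\to E(D)$ is $\varepsilon(I)=\sum\{J : J\in E(D), J\subseteq I\}$, which is the largest idempotent ideal contained in $I$. The composite $\varepsilon\delta:R\to E(D)$ is $x\mapsto\varepsilon((x))$, $\mathrm{Im}(\varepsilon\delta)$ is its image, and $R_e=(\varepsilon\delta)^{-1}(e)$. A semilattice is a commutative semigroup all of whose elements are idempotent. *)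

(* Defs.v *)
From HB Require Import structures.
From mathcomp Require Import all_boot all_order all_algebra.
From mathcomp Require Import all_classical.

Set Implicit Arguments.
Unset Strict Implicit.
Unset Printing Implicit Defensive.

Import GRing.Theory.
Local Open Scope classical_set_scope.
Local Open Scope ring_scope.

Section Semigroups.
Variables (T : Type) (op : T -> T -> T).

Definition op_set (A B : set T) : set T := [set op x y | x in A & y in B].

Definition is_subsemigroup (A : set T) : Prop :=
  [/\ op_set A A `<=` A
    & forall x y z, A x -> A y -> A z -> op x (op y z) = op (op x y) z].

Definition is_semilattice (A : set T) : Prop :=
  [/\ is_subsemigroup A,
      forall x y, A x -> A y -> op x y = op y x
    & forall x, A x -> op x x = x].

End Semigroups.

(* The semigroup (S, opS) is a semilattice of semigroups S[Y; F], where the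
   semilattice Y lives inside a type T carrying the operation opT. *)
Definition semilattice_of_semigroups (S T : Type)
    (opS : S -> S -> S) (opT : T -> T -> T) (Y : set T) (F : T -> set S) : Prop :=
  [/\ is_semilattice opT Y,
      partition Y F [set: S],
      forall e, Y e -> is_subsemigroup opS (F e)
    & forall e f, Y e -> Y f -> op_set opS (F e) (F f) `<=` F (opT e f)].

(* The library's idealr are boolean predicates and proper (1 is excluded);
   here an ideal is an arbitrary, possibly improper, ideal. Closure under
   opposites follows from scaling by -1. *)
Record ideal (R : comPzRingType) := Ideal {
  ideal_set :> set R;
  ideal0 : ideal_set 0;
  idealD : forall x y, ideal_set x -> ideal_set y -> ideal_set (x + y);
  idealMl : forall a x, ideal_set x -> ideal_set (a * x) }.

Section Ideals.
Variable R : comPzRingType.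
Implicit Types (I J : ideal R) (A : set R).

Lemma ideal_eqP I J : (I : set R) = J -> I = J.
Proof.
case: I J => [I I0 ID IM] [J J0 JD JM] /= eIJ.
by case: _ / eIJ J0 JD JM => *; congr Ideal; exact: Prop_irrelevance.
Qed.

Definition finite_sums A : set R :=
  [set x | exists2 s : seq R, (forall y, y \in s -> A y) & x = \sum_(y <- s) y].

Lemma finite_sums0 A : finite_sums A 0.
Proof. by exists [::]; rewrite ?big_nil. Qed.

Lemma finite_sumsD A x y :
  finite_sums A x -> finite_sums A y -> finite_sums A (x + y).
Proof.
move=> [s sA ->] [t tA ->]; exists (s ++ t); last by rewrite big_cat.
by move=> z; rewrite mem_cat => /orP[/sA|/tA].
Qed.

Lemma finite_sumsMl A : (forall a x, A x -> A (a * x)) ->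
  forall a x, finite_sums A x -> finite_sums A (a * x).
Proof.
move=> AM a _ [s sA ->]; exists [seq a * y | y <- s].
  by move=> _ /mapP[y /sA Ay ->]; exact: AM.
by rewrite big_map mulr_sumr.
Qed.

Lemma products_Ml I J a x :
  [set u * v | u in I & v in J] x -> [set u * v | u in I & v in J] (a * x).
Proof.
move=> [u Iu [v Jv <-]]; exists (a * u); first exact: idealMl.
by exists v => //; rewrite mulrA.
Qed.

Definition ideal_mul I J : ideal R :=
  Ideal (@finite_sums0 _) (@finite_sumsD _)
        (finite_sumsMl (@products_Ml I J)).

Lemma bigcup_ideal_Ml (F : set (ideal R)) a x :
  (\bigcup_(J in F) (J : set R)) x -> (\bigcup_(J in F) (J : set R)) (a * x).
Proof. by move=> [J FJ Jx]; exists J => //; exact: idealMl. Qed.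

Definition ideal_sum (F : set (ideal R)) : ideal R :=
  Ideal (@finite_sums0 _) (@finite_sumsD _)
        (finite_sumsMl (@bigcup_ideal_Ml F)).

Lemma principal0 (x : R) : range (fun r => r * x) 0.
Proof. by exists 0; rewrite ?mul0r. Qed.

Lemma principalD (x u v : R) : range (fun r => r * x) u ->
  range (fun r => r * x) v -> range (fun r => r * x) (u + v).
Proof. by move=> [r _ <-] [s _ <-]; exists (r + s); rewrite ?mulrDl. Qed.

Lemma principalMl (x a u : R) :
  range (fun r => r * x) u -> range (fun r => r * x) (a * u).
Proof. by move=> [r _ <-]; exists (a * r); rewrite ?mulrA. Qed.

Definition delta (x : R) : ideal R :=
  Ideal (principal0 x) (@principalD x) (@principalMl x).

Definition idempotent_ideals : set (ideal R) := [set J | ideal_mul J J = J].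

Definition epsilon I : ideal R :=
  ideal_sum [set J | idempotent_ideals J /\ J `<=` I].

(* R_e, the fibre of epsilon \o delta over e. *)
Definition fibre (e : ideal R) : set R := (epsilon \o delta) @^-1` [set e].

End Ideals.

(* Main.v *)
(* epsilon turns products of ideals into products: an idempotent ideal G inside
   I * J lies in I and in J, so G = G * G is inside epsilon I * epsilon J, which
   is itself idempotent and inside I * J. Since delta (x * y) =
   delta x * delta y, the map epsilon \o delta is a morphism from R to a
   semilattice, and R decomposes into its fibres. *)
Require Import Defs.
From mathcomp Require Import all_boot all_order all_algebra.
From mathcomp Require Import all_classical.

Local Open Scope classical_set_scope.
Local Open Scope ring_scope.

Section IdealTheory.
Import GRing.Theory.
Variable R : comPzRingType.
Implicit Types (A : set R) (I J K L : ideal R) (x y : R).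

Lemma ideal_sub_anti I J : I `<=` J -> J `<=` I -> I = J.
Proof. by move=> IJ JI; apply: ideal_eqP; apply/seteqP. Qed.

Lemma finite_sums_ind A (P : R -> Prop) :
  P 0 -> (forall x y, P x -> P y -> P (x + y)) -> A `<=` P ->
  forall x, finite_sums A x -> P x.
Proof.
move=> P0 PD AP x [s sA ->].
rewrite big_seq; elim/big_ind: _ => // y ys.
exact/AP/sA.
Qed.

Lemma finite_sums_sub A I : A `<=` I -> finite_sums A `<=` I.
Proof.
move=> AI x; apply: finite_sums_ind => //; first exact: ideal0.
exact: idealD.
Qed.

Lemma sub_finite_sums A : A `<=` finite_sums A.
Proof.
move=> x Ax; exists [:: x]; last by rewrite big_seq1.
by move=> y; rewrite inE => /eqP ->.
Qed.

(** Finite sums of products [u * v] stay in [K], so an inclusion out of a product ideal is tested on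
    these generators alone. *)
Lemma ideal_mul_sub I J K :
  (forall u v, ideal_set I u -> ideal_set J v -> ideal_set K (u * v)) ->
  ideal_mul I J `<=` K.
Proof.
move=> IJK; apply: finite_sums_sub => _ [u Iu [v Jv <-]].
exact: IJK.
Qed.

Lemma mem_ideal_mul I J x y :
  ideal_set I x -> ideal_set J y -> ideal_set (ideal_mul I J) (x * y).
Proof. by move=> Ix Jy; apply: sub_finite_sums; exists x => //; exists y. Qed.

Lemma ideal_mulS I J K L :
  I `<=` K -> J `<=` L -> ideal_mul I J `<=` ideal_mul K L.
Proof.
move=> IK JL; apply: ideal_mul_sub => u v /IK Ku /JL Lv.
exact: mem_ideal_mul.
Qed.

Lemma ideal_mul_subl I J : ideal_mul I J `<=` I.
Proof. by apply: ideal_mul_sub => u v Iu _; rewrite mulrC; exact: idealMl. Qed.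

Lemma ideal_mulC : commutative (@ideal_mul R).
Proof.
suff subC I J : ideal_mul I J `<=` ideal_mul J I.
  by move=> I J; apply: ideal_sub_anti.
by apply: ideal_mul_sub => u v Iu Jv; rewrite mulrC; exact: mem_ideal_mul.
Qed.

Lemma ideal_mul_subr I J : ideal_mul I J `<=` J.
Proof. by rewrite ideal_mulC; exact: ideal_mul_subl. Qed.

Lemma ideal_mulA : associative (@ideal_mul R).
Proof.
have subA I J K :
    ideal_mul I (ideal_mul J K) `<=` ideal_mul (ideal_mul I J) K.
  apply: ideal_mul_sub => u w Iu; move: w.
  (* With [u] fixed, the second factor is a finite sum of products from [J] and [K]; induction over
     that sum leaves a single product [v * w]. *)
  apply: finite_sums_ind => [|x y|_ [v Jv [w Kw <-]]].
  - by rewrite mulr0; exact: ideal0.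
  - by rewrite mulrDr; exact: idealD.
  - by rewrite mulrA; do 2?apply: mem_ideal_mul.
move=> I J K; apply: ideal_sub_anti; first exact: subA.
(* Commutativity turns the reverse inclusion into [K(JI)] inside [(KJ)I], an instance of [subA]. *)
rewrite ideal_mulC (ideal_mulC I J) (ideal_mulC I) (ideal_mulC J K).
exact: subA.
Qed.

(** Regrouping gives [(IJ)(IJ) = (II)(JJ) = IJ]. *)
Lemma idempotent_ideal_mul I J :
  idempotent_ideals I -> idempotent_ideals J ->
  idempotent_ideals (ideal_mul I J).
Proof.
rewrite /idempotent_ideals /= => II JJ.
by rewrite ideal_mulA (ideal_mulC I J) -(ideal_mulA J) II -ideal_mulA
  (ideal_mulC I) ideal_mulA JJ.
Qed.

Lemma delta_mul x y : delta (x * y) = ideal_mul (delta x) (delta y).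
Proof.
apply: ideal_sub_anti.
  (* A multiple of [x * y] splits as [(r * x) * (1 * y)]. *)
  move=> _ [r _ <-]; rewrite mulrA; apply: mem_ideal_mul; first by exists r.
  by exists 1; rewrite ?mul1r.
apply: ideal_mul_sub => _ _ [r _ <-] [s _ <-].
by exists (r * s); rewrite // mulrACA.
Qed.

Lemma epsilon_sub I : epsilon I `<=` I.
Proof. by apply: finite_sums_sub => x [J [_ JI] /JI]. Qed.

Lemma sub_epsilon I J : idempotent_ideals J -> J `<=` I -> J `<=` epsilon I.
Proof. by move=> JJ JI x Jx; apply: sub_finite_sums; exists J. Qed.

(** A generator of [epsilon I] lies in some idempotent [J] inside [I], and [J = JJ] is inside
    [(epsilon I)(epsilon I)] because [J] is inside [epsilon I]. *)
Lemma epsilon_idempotent I : idempotent_ideals (epsilon I).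
Proof.
apply: ideal_sub_anti; first exact: ideal_mul_subl.
apply: finite_sums_sub => x [J [JJ JI] Jx].
rewrite -JJ in Jx; apply: ideal_mulS Jx; exact: sub_epsilon.
Qed.

Lemma epsilon_mul I J :
  epsilon (ideal_mul I J) = ideal_mul (epsilon I) (epsilon J).
Proof.
apply: ideal_sub_anti; last first.
  apply: sub_epsilon; last by apply: ideal_mulS; exact: epsilon_sub.
  by apply: idempotent_ideal_mul; exact: epsilon_idempotent.
(* The idempotent ideal to be squared is [epsilon (IJ)] itself. *)
rewrite -{1}(epsilon_idempotent (ideal_mul I J)).
apply: ideal_mulS; apply: sub_epsilon; try exact: epsilon_idempotent.
- exact: subset_trans (@epsilon_sub _) (@ideal_mul_subl I J).
- exact: subset_trans (@epsilon_sub _) (@ideal_mul_subr I J).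
Qed.

Lemma epsilon_delta_mul x y :
  epsilon (delta (x * y)) = ideal_mul (epsilon (delta x)) (epsilon (delta y)).
Proof. by rewrite delta_mul epsilon_mul. Qed.

Lemma fibre_mul (e f : ideal R) :
  op_set *%R (fibre e) (fibre f) `<=` fibre (ideal_mul e f).
Proof.
move=> _ [x xe [y yf <-]]; move: xe yf.
by rewrite /fibre /= epsilon_delta_mul => -> ->.
Qed.

End IdealTheory.

Theorem theorem2p7 (R : comPzRingType) :
  semilattice_of_semigroups (@GRing.mul R) (@ideal_mul R)
    (range (@epsilon R \o @delta R)) (@fibre R).
Proof.
split.
- split; [split| |].
  + move=> _ [_ [x _ <-] [_ [y _ <-] <-]].
    by exists (x * y) => //=; rewrite epsilon_delta_mul.
  + by move=> *; exact: ideal_mulA.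
  + by move=> *; exact: ideal_mulC.
  + by move=> _ [x _ <-]; exact: epsilon_idempotent.
- split.
  + apply/seteqP; split=> // x _.
    by exists (epsilon (delta x)) => //; exists x.
  (* A common point [x] of two fibres forces both indices to equal [epsilon (delta x)]. *)
  + by move=> e f _ _ [x [<- <-]].
  + by move=> _ [x _ <-]; exists x.
- move=> _ [x _ <-]; split; last by move=> *; exact: GRing.mulrA.
  (* Closure of a fibre is the case [f = e] of [fibre_mul], since [ee = e]. *)
  have ee := epsilon_idempotent R (delta x).
  by rewrite -[X in _ `<=` fibre X]ee; exact: fibre_mul.
- by move=> e f _ _; exact: fibre_mul.
Qed.
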